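(* Let $\mathcal H$ be an infinite dimensional separable complex Hilbert space and let $T$ be a bounded linear operator on $\mathcal H$. Then $T$ satisfies the Diskcyclic Criterion if and only if $T$ satisfies the Diskcyclic Criterion for some sequence $\{\lambda_{n_k}\}$.
   Context: $T$ satisfies the Diskcyclic Criterion if there exist an increasing sequence of positive integers $\{n_k\}$, two dense sets $X,Y\subset\mathcal H$ and a sequence of maps $S_{n_k}:Y\to\mathcal H$ (not assumed linear or continuous) such that, as $k\to\infty$: (1) $\|T^{n_k}x\|\,\|S_{n_k}y\|\to 0$ for all $x\in X$, $y\in Y$; (2) $\|S_{n_k}y\|\to 0$ for all $y\in Y$; (3) $T^{n_k}S_{n_k}y\to y$ for all $y\in Y$. $T$ satisfies the Diskcyclic Criterion for the sequence $\{\lambda_{n_k}\}$ if there exist an increasing sequence of positive integers $\{n_k\}$, a sequence $\{\lambda_{n_k}\}$ in $\mathbb C\setminus\{0\}$ with $|\lambda_{n_k}|\le 1$ for all $k$, two dense sets $X,Y\subset\mathcal H$ and a sequence of maps $S_{n_k}:Y\to\mathcal H$ (not assumed linear or continuous) such that, as $k\to\infty$: (1) $\|\lambda_{n_k}T^{n_k}x\|\to 0$ for all $x\in X$; (2) $\|\frac{1}{\lambda_{n_k}}S_{n_k}y\|\to 0$ for all $y\in Y$; (3) $T^{n_k}S_{n_k}y\to y$ for all $y\in Y$. The sequences, dense sets and maps in the two criteria are not required to be the same. *)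

(* Defs.v *)
From HB Require Import structures.
From mathcomp Require Import all_boot all_order all_algebra.
From mathcomp Require Import complex sesquilinear.
From mathcomp Require Import all_classical all_reals all_analysis.
Set Implicit Arguments.
Unset Strict Implicit.
Unset Printing Implicit Defensive.
Import Order.TTheory GRing.Theory Num.Theory.
Import numFieldNormedType.Exports.
Local Open Scope classical_set_scope.
Local Open Scope ring_scope.
Local Open Scope complex_scope.

Definition separable_space (E : topologicalType) : Prop :=
  exists D : set E, countable D /\ dense D.

Definition finite_dimensional (K : fieldType) (E : lmodType K) : Prop :=
  exists (m : nat) (e : 'I_m -> E),
    forall x : E, exists a : 'I_m -> K, x = \sum_(i < m) a i *: e i.

(* A complete normed space over R[i] whose norm satisfies this for a positive
   definite hermitian form [dot] is a complex Hilbert space.  [dot] is linear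
   in its first argument.  Norms take their values in R[i]. *)
Definition norm_from_dot (R : realType) (H : normedModType R[i])
    (dot : {dot H for Num.conj}) : Prop :=
  forall x : H, `|x| ^+ 2 = dot x x.

Definition bounded_operator (R : realType) (H : normedModType R[i])
    (T : H -> H) : Prop :=
  exists M : R, forall x : H, `|T x| <= M%:C * `|x|.

(* [n k] is n_k and [S k] is S_{n_k}.  The maps S_{n_k} : Y -> H are given by
   total functions whose values outside Y are irrelevant.  R[i]^o carries the
   usual topology of the complex numbers. *)
Definition diskcyclic_criterion (R : realType) (H : normedModType R[i])
    (T : H -> H) : Prop :=
  exists (n : nat -> nat) (X Y : set H) (S : nat -> H -> H),
    [/\ (forall k, (0 < n k)%N) /\ {homo n : i j / (i < j)%N},
        dense X /\ dense Y,
        forall x y, X x -> Y y ->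
          `|iter (n k) T x| * `|S k y| @[k --> \oo] --> (0 : R[i]^o),
        forall y, Y y -> `|S k y| @[k --> \oo] --> (0 : R[i]^o) &
        forall y, Y y -> iter (n k) T (S k y) @[k --> \oo] --> y].

(* [lam k] is \lambda_{n_k}: the sequence is indexed by k. *)
Definition diskcyclic_criterion_for (R : realType) (H : normedModType R[i])
    (T : H -> H) (lam : nat -> R[i]) : Prop :=
  (forall k, lam k != 0 /\ `|lam k| <= 1) /\
  exists (n : nat -> nat) (X Y : set H) (S : nat -> H -> H),
    [/\ (forall k, (0 < n k)%N) /\ {homo n : i j / (i < j)%N},
        dense X /\ dense Y,
        forall x, X x ->
          `|lam k *: iter (n k) T x| @[k --> \oo] --> (0 : R[i]^o),
        forall y, Y y ->
          `|(lam k)^-1 *: S k y| @[k --> \oo] --> (0 : R[i]^o) &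
        forall y, Y y -> iter (n k) T (S k y) @[k --> \oo] --> y].

(* Main.v *)
(** If the criterion for [lam] holds, the same data satisfy the Diskcyclic
    Criterion, since [|T^n x| |S y| = |lam T^n x| |lam^-1 S y|] and [|lam| <= 1].
    Conversely, replace X and Y by dense sequences [x_i], [y_j] in them, and put
    [a = sum_(i <= m) |T^n_k x_i|] and [b = sum_(j <= m) |S_k y_j|].  For fixed m,
    [a * b] and [b] tend to 0 in k, so along a subsequence [k_m] one has
    [a * b < e^2] and [b < e] with [e = 1/(m+1)].  The scalar
    [lam_m = e / (a + e)] is then at most 1, with [lam_m * a <= e] and
    [b / lam_m <= 2e].  Countability is what lets one sequence [lam_m] serve all
    vectors, because each [x_i], [y_j] enters the sums from some m on. *)

Require Import Defs.
From HB Require Import structures.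
From mathcomp Require Import all_boot all_order all_algebra.
From mathcomp Require Import complex sesquilinear.
From mathcomp Require Import all_classical all_reals all_analysis.
Set Implicit Arguments.
Unset Strict Implicit.
Unset Printing Implicit Defensive.
Import Order.TTheory GRing.Theory Num.Theory.
Import numFieldNormedType.Exports.
Local Open Scope classical_set_scope.
Local Open Scope ring_scope.
Local Open Scope complex_scope.

Lemma exists_increasing_near (P : nat -> nat -> Prop) :
  (forall m, \forall k \near \oo, P m k) ->
  exists f : nat -> nat, {homo f : i j / (i < j)%N} /\ forall m, P m (f m).
Proof.
move=> nearP.
have /choice[N NP] m : exists N, forall k, (N <= k)%N -> P m k.
  by have [N _ NP] := nearP m; exists N => k /NP.
(* Partial sums of the thresholds dominate each [N m]; the successor makes every increment positive,
   hence the growth strict. *)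
exists (fun m => \sum_(i < m.+1) (N i).+1)%N; split=> [|m].
  apply: (homo_ltn ltn_trans) => m.
  by rewrite [ltnRHS]big_ord_recr/= addnS ltnS leq_addr.
by apply: NP; rewrite big_ord_recr/= addnS; apply: leqW; rewrite leq_addl.
Qed.

Lemma increasing_cvgny (f : nat -> nat) :
  {homo f : i j / (i < j)%N} -> f k @[k --> \oo] --> \oo.
Proof.
move=> f_incr; have f_ge k : (k <= f k)%N.
  by elim: k => // k ih; apply: leq_ltn_trans ih (f_incr _ _ _).
by apply/cvgnyPge => A; exists A => // k /= Ak; exact: leq_trans Ak (f_ge k).
Qed.

Section complex_inverse_succ.
Variable R : realType.

Definition inv_succ (m : nat) : R[i] := (m.+1%:R^-1 : R)%:C.

Lemma inv_succ_gt0 m : 0 < inv_succ m.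
Proof. by rewrite /inv_succ ltcR invr_gt0 ltr0n. Qed.

Lemma near_inv_succ_lt (e : R[i]) : 0 < e -> \forall m \near \oo, inv_succ m < e.
Proof.
(* A positive element of [R[i]] is real, so the claim reduces to [R]. *)
move=> e0; have /complex_realP[r er] := gtr0_real e0.
move: e0; rewrite er ltcR => r0.
have [N _ NP] := near_infty_natSinv_lt (PosNum r0).
by exists N => // m /NP; rewrite /inv_succ ltcR.
Qed.

Lemma cvg0_le_inv_succ (c : R[i]) (u : nat -> R[i]) (N : nat) :
  (forall k, 0 <= u k) -> 0 < c ->
  (forall k, (N <= k)%N -> u k <= c * inv_succ k) ->
  u k @[k --> \oo] --> (0 : R[i]^o).
Proof.
move=> u_ge0 c0 u_le; apply/(@cvgr0Pnorm_lt _ R[i]^o) => e e0.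
have ec0 : 0 < e / c by rewrite divr_gt0.
near=> k; rewrite (ger0_norm (u_ge0 k)).
apply: le_lt_trans (u_le k _) _; first by near: k; exact: nbhs_infty_ge.
by rewrite mulrC -ltr_pdivlMr//; near: k; exact: near_inv_succ_lt.
Unshelve. all: by end_near. Qed.

End complex_inverse_succ.

(** [X] may miss the countable dense set [D] entirely, so a point of [X] is picked in the ball of
    radius [1/(k+1)] around each [d i]. *)
Lemma dense_seq_in (R : realType) (H : normedModType R[i]) (X : set H) :
  separable_space H -> dense X ->
  exists x : nat -> H, (forall i, X (x i)) /\ dense (range x).
Proof.
move=> [D [/pfcard_geP[D0|[d]] D_dense]] X_dense.
  by have [] := D_dense setT _ openT; [exists 0|rewrite D0 => z []].
have /choice[x xP] (p : nat * nat) :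
    exists z, X z /\ ball (d p.1) (inv_succ R p.2) z.
  have [||z [zb zX]] := X_dense (ball (d p.1) (inv_succ R p.2)).
  - by exists (d p.1); apply: ballxx; exact: inv_succ_gt0.
  - exact: ball_open.
  - by exists z.
(* Indices that code no pair merely repeat [x (0, 0)], which still lies in [X]. *)
exists (fun i => x (odflt (0, 0)%N (unpickle i))); split=> [i|O [z Oz] O_open].
  exact: (xP _).1.
have /nbhs_ballP[e /= e0 eO] : nbhs z O by exact: open_nbhs_nbhs.
have e20 : 0 < e / 2 by rewrite divr_gt0.
have [||w [zw Dw]] := D_dense (ball z (e / 2)).
- by exists z; exact: ballxx.
- exact: ball_open.
have [i _ diw] := 'surj_d Dw.
have [N _ /(_ N (leqnn N)) Ne] := near_inv_succ_lt e20.
exists (x (i, N)); split; last by exists (pickle (i, N)) => //; rewrite pickleK.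
apply: eO; rewrite [e]splitr; apply: ball_triangle zw _.
by have [_] := xP (i, N); rewrite /= diw; apply: le_ball; exact: ltW.
Qed.

(* Witness [e / (a + e)]: multiplying it by [a] gives at most [e], and dividing
   [b] by it gives [a * b / e + b]. *)
Lemma balancing_scalar (K : numFieldType) (a b e : K) :
  0 <= a -> 0 <= b -> 0 < e -> a * b < e ^+ 2 -> b < e ->
  exists l : K, [/\ 0 < l, l <= 1, l * a <= e & l^-1 * b <= 2 * e].
Proof.
move=> a0 b0 e0 ab be; have ae0 : 0 < a + e by rewrite ltr_wpDl.
exists (e / (a + e)); split.
- by rewrite divr_gt0.
- by rewrite ler_pdivrMr// mul1r lerDr.
- by rewrite mulrAC ler_pdivrMr// ler_pM2l// lerDl ltW.
- rewrite invf_div mulrAC ler_pdivrMr// mulrDl -mulrA -expr2 mulr_natl mulr2n.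
  by rewrite lerD// ?(ltW ab)// expr2 ler_pM2l// ltW.
Qed.

Lemma le_sum_term (K : numDomainType) (u : nat -> K) (i m : nat) :
  (forall j, 0 <= u j) -> (i <= m)%N -> u i <= \sum_(j < m.+1) u j.
Proof.
move=> u0 im; rewrite (bigD1 (Ordinal (im : (i < m.+1)%N)))//= lerDl.
by apply: sumr_ge0.
Qed.

Lemma cvg0_sum (K : numFieldType) (I : Type) (r : seq I) (u : I -> nat -> K) :
  (forall i, u i k @[k --> \oo] --> (0 : K^o)) ->
  \sum_(i <- r) u i k @[k --> \oo] --> (0 : K^o).
Proof.
move=> u0; rewrite -[X in _ --> X](@big1_eq K 0 +%R I r predT).
by apply: (@cvg_big K^o I +%R) => //; exact: add_continuous.
Qed.

Theorem proposition2p8 (R : realType) (H : completeNormedModType R[i])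
    (dot : {dot H for Num.conj}) (hdot : norm_from_dot dot)
    (hinf : ~ finite_dimensional H) (hsep : separable_space H)
    (T : {linear H -> H}) (hT : bounded_operator T) :
  diskcyclic_criterion T <->
  exists lam : nat -> R[i], diskcyclic_criterion_for T lam.
Proof.
split.
  move=> [n [X [Y [S [[n_gt0 n_incr] [X_dense Y_dense] TS0 S0 TSy]]]]].
  have [x [xX x_dense]] := dense_seq_in hsep X_dense.
  have [y [yY y_dense]] := dense_seq_in hsep Y_dense.
  pose a (m k : nat) := \sum_(i < m.+1) `|iter (n k) T (x i)|.
  pose b (m k : nat) := \sum_(j < m.+1) `|S k (y j)|.
  have a_ge0 m k : 0 <= a m k by apply: sumr_ge0.
  have b_ge0 m k : 0 <= b m k by apply: sumr_ge0.
  have ab_cvg m : a m k * b m k @[k --> \oo] --> (0 : R[i]^o).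
    (* For fixed [m] the product expands into a finite double sum, each term of which tends to 0 by
       [TS0]. *)
    under eq_fun do rewrite /a /b big_distrl/=.
    apply: cvg0_sum => i; under eq_fun do rewrite big_distrr/=.
    by apply: cvg0_sum => j; exact: TS0.
  have b_cvg m : b m k @[k --> \oo] --> (0 : R[i]^o).
    by apply: cvg0_sum => j; exact: S0.
  have e0 := @inv_succ_gt0 R.
  have [|s [s_incr sP]] := @exists_increasing_near (fun m k =>
      a m k * b m k < inv_succ R m ^+ 2 /\ b m k < inv_succ R m).
    move=> m; near=> k; split.
    - rewrite -[ltLHS]ger0_norm ?mulr_ge0//; near: k.
      by apply: (@cvgr0_norm_lt _ R[i]^o) => //; rewrite exprn_gt0.
    - rewrite -[ltLHS]ger0_norm//; near: k.
      exact: (@cvgr0_norm_lt _ R[i]^o).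
  have /choice[lam lamP] m : exists l : R[i], [/\ 0 < l, l <= 1,
      l * a m (s m) <= inv_succ R m & l^-1 * b m (s m) <= 2 * inv_succ R m].
    by have [ab be] := sP m; exact: balancing_scalar.
  exists lam; split.
    by move=> m; have [l0 l1 _ _] := lamP m; rewrite gt_eqF// gtr0_norm.
  exists (n \o s), (range x), (range y), (S \o s); split => //.
  - by split=> [k|i j ij]; [exact: n_gt0|apply: n_incr; exact: s_incr].
  (* The bound starts at [m = i], where the norm for [x i] becomes a term of [a m (s m)]. *)
  - move=> _ [i _ <-]; apply: (@cvg0_le_inv_succ _ 1 _ i) => // m im.
    have [l0 _ la _] := lamP m.
    rewrite normrZ (gtr0_norm l0) mul1r (le_trans _ la)// ler_pM2l//.
    exact: (@le_sum_term _ (fun i => `|iter (n (s m)) T (x i)|)).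
  - move=> _ [j _ <-]; apply: (@cvg0_le_inv_succ _ 2 _ j) => // m jm.
    have [l0 _ _ lb] := lamP m.
    have li0 : 0 < (lam m)^-1 by rewrite invr_gt0.
    rewrite normrZ (gtr0_norm li0) (le_trans _ lb)// ler_pM2l//.
    exact: (@le_sum_term _ (fun j => `|S (s m) (y j)|)).
  - move=> _ [j _ <-]; apply: cvg_comp (TSy _ (yY j)).
    exact: increasing_cvgny.
move=> [lam [lamP [n [X [Y [S [n_incr XY_dense lT0 lS0 TSy]]]]]]].
exists n, X, Y, S; split => //.
- move=> x y /lT0 Tx0 /lS0 Sy0.
  (* The factors [lam k] and [(lam k)^-1] cancel in the product of norms. *)
  have -> : (fun k => `|iter (n k) T x| * `|S k y|) =
      (fun k => `|lam k *: iter (n k) T x| * `|(lam k)^-1 *: S k y|).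
    apply/funext => k; have [l0 _] := lamP k.
    by rewrite !normrZ mulrACA -normrM divff// normr1 mul1r.
  by rewrite -[0 in X in _ --> X](mulr0 0); exact: (@cvgM R[i]).
- move=> y /lS0 Sy0; apply/(@cvgr0Pnorm_lt _ R[i]^o) => e e0.
  apply: (filterS _ (@cvgr0_norm_lt _ R[i]^o _ _ _ _ Sy0 e e0)) => k.
  apply: le_lt_trans.
  have [l0 l1] := lamP k.
  (* Scaling by [(lam k)^-1] cannot shrink [S k y], since [lam k] has modulus at most 1. *)
  by rewrite !normr_id normrZ normfV ler_peMl// invf_ge1// normr_gt0.
Unshelve. all: by end_near. Qed.
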